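(* Let $R>r>0$, let $\mathcal{T}\subset\mathbb{R}^3$ be the torus with radii $R,r$, let $d\ge 0$ be a fixed integer, let $\delta_0>0$ be a tubular radius of $\mathcal{T}$, and fix $0<\delta_1<\delta_0$. There is a constant $C_{\mathcal{T},d,\delta_1}>0$, independent of $h$, $\mu$ and $f$, with the following property. Let $\{X_h\}$ be a family of finite node sets on $\mathcal{T}$ with families of unisolvent stencils $\Sigma_h=\{\sigma_{1,h},\ldots,\sigma_{L_h,h}\}$ covering $X_h$, support radii $R_{j,h}>0$, and associated compactly supported multinode Shepard operators $\widetilde{\mathcal{M}}_{\mu,h}$ of degree $d$. If $\rho_h<\delta_1$, then for every $\mu>0$ and every $f\in C^{d+1}(\mathcal{T})$, $$\|f-\widetilde{\mathcal{M}}_{\mu,h}[f]\|_{L^\infty(\mathcal{T})}\le C_{\mathcal{T},d,\delta_1}\,\Lambda_h\,\rho_h^{d+1}\,\|f\|_{C^{d+1}(\mathcal{T})}.$$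
   Context: For $R>r>0$, the torus is $\mathcal{T}=\{(x,y,z)\in\mathbb{R}^3:(\sqrt{x^2+y^2}-R)^2+z^2=r^2\}$, parametrized by $\Phi(\theta,\phi)=((R+r\cos\theta)\cos\phi,(R+r\cos\theta)\sin\phi,r\sin\theta)$, viewed as a map $\mathbb{R}^2/(2\pi\mathbb{Z})^2\to\mathcal{T}$. $\mathcal{H}_d(\mathcal{T})=\{p|_{\mathcal{T}}:p\text{ a real polynomial in }x,y,z\text{ of total degree}\le d\}$ and $m_d=\dim\mathcal{H}_d(\mathcal{T})$. A set of $m_d$ distinct points of $\mathcal{T}$ is unisolvent for $\mathcal{H}_d(\mathcal{T})$ if for arbitrary prescribed real values at these points there is exactly one element of $\mathcal{H}_d(\mathcal{T})$ taking these values. $d_E(\boldsymbol{x},\boldsymbol{y})=\|\boldsymbol{x}-\boldsymbol{y}\|_2$. Tubular radius: a number $\delta_0>0$ such that every point of $\{\boldsymbol{y}\in\mathbb{R}^3:\operatorname{dist}(\boldsymbol{y},\mathcal{T})<\delta_0\}$ has a unique nearest point on $\mathcal{T}$ and the resulting nearest-point projection onto $\mathcal{T}$ is smooth. Norm: $\|f\|_{C^k(\mathcal{T})}=\max_{|\alpha|\le k}\|\partial^\alpha(f\circ\Phi)\|_{L^\infty([0,2\pi]^2)}$, with $f\circ\Phi$ identified with its $2\pi$-periodic lift to $\mathbb{R}^2$. The $L^\infty(\mathcal{T})$ norm is the supremum over $\mathcal{T}$. Family of operators. $\{X_h\}$ is a family of finite sets of pairwise distinct nodes on $\mathcal{T}$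 indexed by its fill distance $h=\sup_{\boldsymbol{x}\in\mathcal{T}}\min_{\boldsymbol{\xi}\in X_h}d_E(\boldsymbol{x},\boldsymbol{\xi})$, with $h\to0$. For each $h$, $\Sigma_h=\{\sigma_{1,h},\ldots,\sigma_{L_h,h}\}$ is a family of stencils $\sigma_{j,h}=\{\boldsymbol{x}_{j_1,h},\ldots,\boldsymbol{x}_{j_{m_d},h}\}\subset X_h$, each unisolvent for $\mathcal{H}_d(\mathcal{T})$, with $X_h=\bigcup_j\sigma_{j,h}$. $P_{j,h}[f]\in\mathcal{H}_d(\mathcal{T})$ is the unique interpolant of $f$ on $\sigma_{j,h}$, and $\ell_{j_1,h},\ldots,\ell_{j_{m_d},h}\in\mathcal{H}_d(\mathcal{T})$ are the fundamental polynomials, $\ell_{j_k,h}(\boldsymbol{x}_{j_\ell,h})=\delta_{k\ell}$. With support radii $R_{j,h}>0$ and $\mu>0$, for $\boldsymbol{x}\in\mathcal{T}\setminus X_h$ set $$\omega_{\mu,j,h}(\boldsymbol{x})=\prod_{\ell=1}^{m_d}\left(\frac{1}{d_E(\boldsymbol{x},\boldsymbol{x}_{j_\ell,h})}-\frac{1}{R_{j,h}}\right)_+^{\mu},\qquad(t)_+=\max\{t,0\}.$$ Let $C_{j,h}=\bigcap_{\ell=1}^{m_d}\{\boldsymbol{\xi}\in\mathcal{T}:d_E(\boldsymbol{\xi},\boldsymbol{x}_{j_\ell,h})\le R_{j,h}\}$ and, for $\boldsymbol{x}\in\mathcal{T}$, $J_{\boldsymbol{x},h}=\{j:\boldsymbol{x}\in\text{interior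 of }C_{j,h}\text{ in }\mathcal{T}\}$. Standing assumption: the radii are such that $J_{\boldsymbol{x},h}\ne\emptyset$ for all $\boldsymbol{x}\in\mathcal{T}$ and $\sum_{k\in J_{\boldsymbol{x},h}}\omega_{\mu,k,h}(\boldsymbol{x})>0$ for all $\boldsymbol{x}\in\mathcal{T}\setminus X_h$ (this holds for instance for $R_{j,h}=\max_{\boldsymbol{x},\boldsymbol{y}\in\sigma_{j,h}}d_E(\boldsymbol{x},\boldsymbol{y})+H_h$ with $H_h>h$). The normalized weights are $\widetilde W_{\mu,j,h}(\boldsymbol{x})=\omega_{\mu,j,h}(\boldsymbol{x})/\sum_{k\in J_{\boldsymbol{x},h}}\omega_{\mu,k,h}(\boldsymbol{x})$ for $j\in J_{\boldsymbol{x},h}$, and $0$ otherwise. The compactly supported multinode Shepard operator is $$\widetilde{\mathcal{M}}_{\mu,h}[f](\boldsymbol{x})=\begin{cases}\displaystyle\sum_{j\in J_{\boldsymbol{x},h}}\widetilde W_{\mu,j,h}(\boldsymbol{x})P_{j,h}[f](\boldsymbol{x}),&\boldsymbol{x}\in\mathcal{T}\setminus X_h,\\ f(\boldsymbol{x}),&\boldsymbol{x}\in X_h.\end{cases}$$ Maximal support radius and local stability factor: $$\rho_h=\max_{1\le j\le L_h}R_{j,h},\qquad \Lambda_h=\sup_{\boldsymbol{x}\in\mathcal{T}}\ \max_{j\in J_{\boldsymbol{x},h}}\ \sum_{k=1}^{m_d}|\ell_{j_k,h}(\boldsymbol{x})|.$$ *)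

(* Defs.v *)
(* The notations of mpoly clash with those of mathcomp-analysis. *)
From HB Require Import structures.
From mathcomp Require Import all_boot all_order all_algebra.
From mathcomp Require mpoly.
Import (canonicals, coercions) mpoly.
From mathcomp Require Import all_classical all_reals all_analysis.

Set Implicit Arguments.
Unset Strict Implicit.
Unset Printing Implicit Defensive.

Import Order.TTheory GRing.Theory Num.Theory.
Import numFieldNormedType.Exports.

Local Open Scope classical_set_scope.
Local Open Scope ring_scope.

(* The library norm on 'rV[R]_n is the max norm, hence an explicit Euclidean
   distance; both induce the same topology. *)
Definition dE (R : realType) n (x y : 'rV[R]_n) : R :=
  Num.sqrt (\sum_i (x 0 i - y 0 i) ^+ 2).

Definition supnorm (R : realType) (X : Type) (A : set X) (g : X -> R) : \bar R :=
  ereal_sup [set `|g x|%:E | x in A].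

Section Differentiability.
Variables (R : realType) (n : nat).
Implicit Types (U : set 'rV[R]_n) (g : 'rV[R]_n -> R).

Definition partial (i : 'I_n) g : 'rV[R]_n -> R := fun x => 'D_('e_i) g x.

(* U is meant to be open: only the values of g on U matter then. *)
Fixpoint Ck_on U (k : nat) g : Prop :=
  (forall x, U x -> {for x, continuous g}) /\
  if k is k'.+1 then
    forall i : 'I_n, (forall x, U x -> derivable g x 'e_i) /\
                     Ck_on U k' (partial i g)
  else True.

Definition smooth_on U g : Prop := forall k, Ck_on U k g.

End Differentiability.

Section Torus.
Variables (R : realType) (Rt r : R).

Definition torus : set 'rV[R]_3 :=
  [set x | (Num.sqrt (x 0 0 ^+ 2 + x 0 1 ^+ 2) - Rt) ^+ 2 + x 0 2 ^+ 2 = r ^+ 2].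

(* The pair (theta, phi) is (u 0 0, u 0 1). *)
Definition Phi (u : 'rV[R]_2) : 'rV[R]_3 :=
  \row_(i < 3) nth 0 [:: (Rt + r * cos (u 0 0)) * cos (u 0 1);
                         (Rt + r * cos (u 0 0)) * sin (u 0 1);
                         r * sin (u 0 0)] i.

Definition dist_torus (y : 'rV[R]_3) : R := inf [set dE y t | t in torus].

Definition tube (delta : R) : set 'rV[R]_3 := [set y | dist_torus y < delta].

Definition tubular_radius (delta : R) : Prop :=
  0 < delta /\
  exists proj : 'rV[R]_3 -> 'rV[R]_3,
    (forall y, tube delta y ->
       torus (proj y) /\
       forall t, torus t -> t != proj y -> dE y (proj y) < dE y t) /\
    (forall i : 'I_3, smooth_on (tube delta) (fun y => proj y 0 i)).

(* Functions on the torus are represented by functions on the ambient space,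
   whose values off the torus are irrelevant. *)

Definition Ck_torus (k : nat) (f : 'rV[R]_3 -> R) : Prop :=
  Ck_on setT k (f \o Phi).

Definition period_square : set 'rV[R]_2 :=
  [set u | forall i, 0 <= u 0 i <= 2 * pi].

(* The partial derivatives involved are continuous for f in C^k, so that their
   essential supremum over the square is a supremum. *)
Definition Ck_norm (k : nat) (f : 'rV[R]_3 -> R) : \bar R :=
  \big[maxe/0%E]_(a : 'I_k.+1 * 'I_k.+1 | (a.1 + a.2 <= k)%N)
    supnorm period_square (iter a.1 (partial 0) (iter a.2 (partial 1) (f \o Phi))).

(* [msize] is the total degree plus one (and is 0 for the zero polynomial). *)
Definition polyspace (d : nat) : set ('rV[R]_3 -> R) :=
  [set p | exists q : mpoly.mpoly 3 R, (mpoly.msize q <= d.+1)%N /\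
           forall x, torus x -> p x = mpoly.meval (fun i => x 0 i) q].

(* Dimension of a space V of functions on the torus, by means of a basis;
   functions are compared on the torus only. *)
Definition has_dim (V : set ('rV[R]_3 -> R)) (m : nat) : Prop :=
  exists b : 'I_m -> 'rV[R]_3 -> R,
    [/\ forall i, V (b i),
        forall c : 'I_m -> R,
          (forall x, torus x -> \sum_i c i * b i x = 0) -> forall i, c i = 0
      & forall p, V p -> exists c : 'I_m -> R,
          forall x, torus x -> p x = \sum_i c i * b i x].

Definition interpolates m (s : 'I_m -> 'rV[R]_3) (y : 'I_m -> R)
    (p : 'rV[R]_3 -> R) : Prop := forall k, p (s k) = y k.

Definition unisolvent (d m : nat) (s : 'I_m -> 'rV[R]_3) : Prop :=
  forall y : 'I_m -> R, exists p,
    [/\ polyspace d p, interpolates s y p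
      & forall q, polyspace d q -> interpolates s y q ->
          forall x, torus x -> q x = p x].

(* For a unisolvent stencil the values on the torus do not depend on the
   choice made by [xget]; the default value 0 is not used then. *)
Definition interpolant (d m : nat) (s : 'I_m -> 'rV[R]_3) (y : 'I_m -> R) :
    'rV[R]_3 -> R :=
  xget (fun=> 0) [set p | polyspace d p /\ interpolates s y p].

Definition fundamental_poly (d m : nat) (s : 'I_m -> 'rV[R]_3) (k : 'I_m) :
    'rV[R]_3 -> R :=
  interpolant d s (fun l => (k == l)%:R).

End Torus.

Record node_system (R : realType) (m : nat) := NodeSystem {
  nodes : set 'rV[R]_3 ;
  nstencils : nat ;
  stencil : 'I_nstencils -> 'I_m -> 'rV[R]_3 ;
  support_radius : 'I_nstencils -> R }.

Section Shepard.
Variables (R : realType) (Rt r : R) (d m : nat).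
Implicit Types (N : node_system R m) (x : 'rV[R]_3).

Definition fill_distance N : \bar R :=
  ereal_sup [set ereal_inf [set (dE x xi)%:E | xi in nodes N] | x in torus Rt r].

Definition valid_node_system N : Prop :=
  [/\ finite_set (nodes N),
      nodes N `<=` torus Rt r,
      nodes N = \bigcup_(j in [set: 'I_(nstencils N)]) range (stencil j),
      forall j : 'I_(nstencils N),
        injective (stencil j) /\ unisolvent Rt r d (stencil j)
    & forall j : 'I_(nstencils N), 0 < support_radius j].

Definition stencil_support N (j : 'I_(nstencils N)) : set 'rV[R]_3 :=
  [set xi | torus Rt r xi /\ forall l, dE xi (stencil j l) <= support_radius j].

(* In the type [subspace A] a point of A has the neighbourhoods of the
   topology induced on A: this is the interior relative to the torus. *)
Definition active N x : set 'I_(nstencils N) :=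
  [set j | torus Rt r x /\
           interior (stencil_support j : set (subspace (torus Rt r))) x].
Arguments active : clear implicits.

Definition weight N (mu : R) (j : 'I_(nstencils N)) x : R :=
  \prod_(l < m) (Num.max ((dE x (stencil j l))^-1 - (support_radius j)^-1) 0 `^ mu).

Definition total_weight N (mu : R) x : R :=
  \sum_(k < nstencils N | k \in active N x) weight mu k x.

Definition normalized_weight N (mu : R) (j : 'I_(nstencils N)) x : R :=
  if j \in active N x then weight mu j x / total_weight N mu x else 0.

Definition admissible_radii N (mu : R) : Prop :=
  (forall x, torus Rt r x -> active N x !=set0) /\
  (forall x, torus Rt r x -> ~ nodes N x -> 0 < total_weight N mu x).

Definition local_interpolant N (j : 'I_(nstencils N)) (f : 'rV[R]_3 -> R) :
    'rV[R]_3 -> R :=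
  interpolant Rt r d (stencil j) (f \o stencil j).

Definition shepard N (mu : R) (f : 'rV[R]_3 -> R) x : R :=
  if x \in nodes N then f x
  else \sum_(j < nstencils N | j \in active N x)
         normalized_weight mu j x * local_interpolant j f x.

(* The maximum of the support radii (these are positive). *)
Definition max_radius N : R :=
  \big[Num.max/0]_(j < nstencils N) support_radius j.

Definition stability_factor N : \bar R :=
  ereal_sup [set
    (\big[Num.max/0]_(j < nstencils N | j \in active N x)
       \sum_(k < m) `|fundamental_poly Rt r d (stencil j) k x|)%:E
    | x in torus Rt r].

(* The members of the family are indexed by the set I of their fill
   distances; h -> 0 means that I contains arbitrarily small elements. *)
Definition node_family (I : set R) (N : R -> node_system R m) : Prop :=
  [/\ forall h, I h -> 0 < h,
      forall e, 0 < e -> exists2 h, I h & h < e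
    & forall h, I h -> valid_node_system (N h) /\ fill_distance (N h) = h%:E].

End Shepard.
Arguments active {R} Rt r {m} N x.

(* Main.v *)
(* The heart of the matter is a local polynomial approximation: for x on the
   torus there is a polynomial q of degree at most d with q(x) = f(x) and
   |f(y) - q(y)| <= C ||f|| |x - y|^(d+1) on the torus. Since f - P_j[f] =
   (f - q) - P_j[f - q], this bounds f - P_j[f] at x by the Lebesgue function of
   the stencil times C ||f|| rho^(d+1), and the weights average these bounds.

   The polynomial q is found in the angles: f o Phi has a Taylor polynomial in
   the increments (t, s), and every monomial t^i s^j is, up to an error of order
   d+1, the restriction of a polynomial of degree at most d in x, y, z. Indeed
   two affine functions on the space agree with t and s to first order on the
   torus, so their products of powers reproduce t^i s^j up to monomials of
   higher order, which are handled by downward induction. All constants are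
   uniform in the base point. No extension of f off the torus is involved. *)
Require Import Defs.
From HB Require Import structures.
From mathcomp Require Import all_boot all_order all_algebra.
From mathcomp Require mpoly.
Import (canonicals, coercions) mpoly.
From mathcomp Require Import all_classical all_reals all_analysis.
From mathcomp Require Import ring lra zify.
Import Order.TTheory GRing.Theory Num.Theory.
Import numFieldNormedType.Exports.
Local Open Scope classical_set_scope.
Local Open Scope ring_scope.

Set Implicit Arguments.
Unset Strict Implicit.
Unset Printing Implicit Defensive.

(** * Closure properties of polynomials restricted to the torus *)

Section Polyspace.
Variables (R : realType) (Rt r : R).
Implicit Types (p q : 'rV[R]_3 -> R).

Lemma polyspace_cst d (c : R) : polyspace Rt r d (fun=> c).
Proof.
exists (c *: 1); split.
  by apply: (leq_trans (mpoly.msizeZ_le _ _)); rewrite mpoly.msize1.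
by move=> x _; rewrite mpoly.mevalZ mpoly.meval1 mulr1.
Qed.

Lemma polyspace_coord (i : 'I_3) : polyspace Rt r 1 (fun x => x 0 i).
Proof.
exists (mpoly.mpolyX R (mpoly.mnm1 i)); split.
  by rewrite mpoly.msizeX mpoly.mdeg1.
by move=> x _; rewrite mpoly.mevalXU.
Qed.

Lemma polyspaceD d p q : polyspace Rt r d p -> polyspace Rt r d q ->
  polyspace Rt r d (fun x => p x + q x).
Proof.
move=> [p' [sp ep]] [q' [sq eq]]; exists (p' + q'); split.
  by apply: (leq_trans (mpoly.msizeD_le _ _)); rewrite geq_max sp sq.
by move=> x Tx; rewrite mpoly.mevalD ep// eq.
Qed.

Lemma polyspaceZ d (c : R) p : polyspace Rt r d p ->
  polyspace Rt r d (fun x => c * p x).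
Proof.
move=> [p' [sp ep]]; exists (c *: p'); split.
  exact: leq_trans (mpoly.msizeZ_le _ _) sp.
by move=> x Tx; rewrite mpoly.mevalZ ep.
Qed.

Lemma polyspaceM d e p q : polyspace Rt r d p -> polyspace Rt r e q ->
  polyspace Rt r (d + e) (fun x => p x * q x).
Proof.
move=> [p' [sp ep]] [q' [sq eq]]; exists (p' * q'); split; last first.
  by move=> x Tx; rewrite mpoly.mevalM ep// eq.
(* The size of a product is the sum of the sizes less one only when both factors are nonzero. *)
have [->|p0] := eqVneq p' 0; first by rewrite mul0r mpoly.msize0.
have [->|q0] := eqVneq q' 0; first by rewrite mulr0 mpoly.msize0.
rewrite mpoly.msizeM//.
have : (mpoly.msize p' + mpoly.msize q' <= d.+1 + e.+1)%N by exact: leq_add.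
by move: (_ + _)%N => [|n] //=; rewrite addnS ltnS.
Qed.

Lemma polyspaceX d p i : polyspace Rt r d p ->
  polyspace Rt r (d * i) (fun x => p x ^+ i).
Proof.
move=> dp; elim: i => [|i ih].
  under eq_fun do rewrite expr0; exact: polyspace_cst.
under eq_fun do rewrite exprS; rewrite mulnS; exact: polyspaceM.
Qed.

Lemma polyspaceW d e p : (d <= e)%N -> polyspace Rt r d p -> polyspace Rt r e p.
Proof.
by move=> de [q [sq eq]]; exists q; split => //; exact: leq_trans sq _.
Qed.

Lemma polyspace_sum d (I : Type) (s : seq I) (P : pred I)
    (p : I -> 'rV[R]_3 -> R) : (forall i, P i -> polyspace Rt r d (p i)) ->
  polyspace Rt r d (fun x => \sum_(i <- s | P i) p i x).
Proof.
move=> dp; elim: s => [|i s ih].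
  under eq_fun do rewrite big_nil; exact: polyspace_cst.
under eq_fun do rewrite big_cons.
by case: (boolP (P i)) => // Pi; apply: polyspaceD => //; exact: dp.
Qed.

End Polyspace.

(** * Taylor's formula in one variable *)

Section Taylor.
Variable R : realType.

Lemma mvt0 (g dg : R -> R) (t : R) : (forall x : R, is_derive x (1 : R) g (dg x)) ->
  exists2 c, `|c| <= `|t| & g t - g 0 = dg c * t.
Proof.
move=> dgE.
have cg : continuous g.
  move=> x; apply: differentiable_continuous; apply/derivable1_diffP.
  exact: (@ex_derive _ _ _ _ _ _ _ (dgE x)).
have [t0|t0] := leP 0 t.
  have [|c cI ->] := MVT_segment t0 (fun x _ => dgE x).
    exact: continuous_subspaceT.
  move: cI; rewrite in_itv/= => /andP[c0 ct]; exists c; last by rewrite subr0.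
  by rewrite !ger0_norm.
have [|c cI e] := MVT_segment (ltW t0) (fun x _ => dgE x).
  exact: continuous_subspaceT.
move: cI; rewrite in_itv/= => /andP[ct c0]; exists c.
  by rewrite !ler0_norm// ?lerN2// ltW.
by apply/eqP; rewrite -opprB e sub0r mulrN opprK.
Qed.

(** The sequence [g] lists a function and its successive derivatives, so that shifting it feeds the
    induction: by the mean value theorem the remainder of [g 0] is [t] times the remainder of [g 1],
    of one order less, at a point no farther from 0. *)
Lemma taylor1 n : forall (g : nat -> R -> R) (M : R),
  (forall k (x : R), (k < n)%N -> is_derive x (1 : R) (g k) (g k.+1 x)) ->
  (forall x, `|g n x| <= M) ->
  forall t, `|g 0%N t - \sum_(k < n) g k 0 / k`!%:R * t ^+ k| <= M * `|t| ^+ n.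
Proof.
elim: n => [g M _ gM t|n ih g M dg gM t].
  by rewrite big_ord0 subr0 expr0 mulr1.
(* The Taylor polynomial as a formal polynomial: differentiating its coefficients yields the Taylor
   polynomial of [g 1]. *)
pose P := \poly_(k < n.+1) (g k 0 / k`!%:R).
have PE x : \sum_(k < n.+1) g k 0 / k`!%:R * x ^+ k = P.[x].
  by rewrite horner_poly.
have P'E x : P^`().[x] = \sum_(k < n) g k.+1 0 / k`!%:R * x ^+ k.
  have -> : P^`() = \poly_(k < n) (g k.+1 0 / k`!%:R).
    apply/polyP => k; rewrite coef_deriv !coef_poly ltnS.
    case: ifP => _; last by rewrite mul0rn.
    have k0 : k.+1%:R != 0 :> R by rewrite pnatr_eq0.
    have f0 : k`!%:R != 0 :> R by rewrite pnatr_eq0 -lt0n fact_gt0.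
    rewrite factS natrM -[LHS]mulr_natr.
    move: k0 f0; move: (k.+1%:R : R) (k`!%:R : R) => a b a0 b0.
    by field; rewrite a0 b0.
  by rewrite horner_poly.
have dR (x : R) : is_derive x (1 : R) (g 0%N - horner P) (g 1%N x - P^`().[x]).
  by apply: is_deriveB; exact: dg.
have [c ct] := mvt0 t dR.
rewrite !fctE -!PE => e.
have -> : g 0%N t - \sum_(k < n.+1) g k 0 / k`!%:R * t ^+ k =
   (g 1%N c - P^`().[c]) * t.
  move: e.
  have -> : \sum_(k < n.+1) g k 0 / k`!%:R * 0 ^+ k = g 0%N 0.
    rewrite big_ord_recl big1 => [|k _]; last by rewrite expr0n/= mulr0.
    by rewrite fact0 expr0; field.
  by move=> <-; ring.
rewrite normrM exprSr mulrA ler_wpM2r// P'E.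
have M0 : 0 <= M by apply: le_trans (gM 0).
apply: (le_trans (ih (fun k => g k.+1) M _ gM c)).
  by move=> k x kn; exact: dg.
by rewrite ler_wpM2l// lerXn2r ?nnegrE.
Qed.

End Taylor.

(** * Calculus of jets in the angle increments *)

Section Jets.
Variables (R : realType) (n : nat).
Implicit Types (g h : R -> R -> R -> R -> R) (a b t s : R) (c : R -> R -> R).

(** Increments in [[-pi, pi]] reach every point of the torus and keep all monomials bounded. *)
Definition bigO g := exists C : R, 0 <= C /\ forall a b t s,
  `|t| <= pi -> `|s| <= pi -> `|g a b t s| <= C * (`|t| + `|s|) ^+ n.

(* [a, b] are the angles of the base point and [t, s] the increments: these are
   the functions of order [k] in [(t, s)] up to errors of order [n], with
   coefficients and error bounds uniform in the base point. *)
Inductive jet (k : nat) : (R -> R -> R -> R -> R) -> Prop :=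
| jet_mono c i j : (exists B, forall a b, `|c a b| <= B) -> (k <= i + j)%N ->
    jet k (fun a b t s => c a b * t ^+ i * s ^+ j)
| jet_bigO g : bigO g -> jet k g
| jet_add g h : jet k g -> jet k h -> jet k (fun a b t s => g a b t s + h a b t s).

Lemma jet_eq k g h : (forall a b t s, g a b t s = h a b t s) -> jet k g -> jet k h.
Proof.
move=> gh; suff -> : h = g by [].
by do 4!(apply: funext => ?); rewrite gh.
Qed.

Lemma jetW k l g : (k <= l)%N -> jet l g -> jet k g.
Proof.
move=> kl; elim=> [c i j Bc lij|g' Og|g1 g2 _ k1 _ k2].
- by apply: jet_mono => //; exact: leq_trans lij.
- exact: jet_bigO.
- exact: jet_add.
Qed.

Lemma bounded_bigO g h : bigO g ->
  (exists B, 0 <= B /\ forall a b t s, `|t| <= pi -> `|s| <= pi -> `|h a b t s| <= B) ->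
  bigO (fun a b t s => g a b t s * h a b t s).
Proof.
move=> [C [C0 gC]] [B [B0 hB]]; exists (C * B); split; first exact: mulr_ge0.
move=> a b t s tp sp; rewrite normrM mulrAC ler_pM//; first exact: gC.
exact: hB.
Qed.

(** Lets an error term absorb multiplication by any jet. *)
Lemma jet_bounded k g : jet k g ->
  exists B, 0 <= B /\ forall a b t s, `|t| <= pi -> `|s| <= pi -> `|g a b t s| <= B.
Proof.
have pi0 : 0 <= pi :> R by exact: pi_ge0.
elim=> [c i j [B cB] _|g' [C [C0 gC]]|g1 g2 _ [B1 [B10 g1B]] _ [B2 [B20 g2B]]].
- have B0 : 0 <= B by apply: le_trans (cB 0 0).
  exists (B * pi ^+ i * pi ^+ j); split.
    by rewrite !mulr_ge0// exprn_ge0// pi_ge0.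
  move=> a b t s tp sp; rewrite !normrM !normrX.
  by rewrite !ler_pM// ?mulr_ge0// ?exprn_ge0// lerXn2r// ?nnegrE ?pi_ge0.
- exists (C * (pi + pi) ^+ n); split.
    by rewrite mulr_ge0// exprn_ge0// addr_ge0// pi_ge0.
  move=> a b t s tp sp; apply: (le_trans (gC _ _ _ _ tp sp)).
  have pp0 : 0 <= pi + pi :> R by exact: addr_ge0.
  by rewrite ler_wpM2l//; apply: lerXn2r; rewrite ?nnegrE ?pp0 ?addr_ge0 ?lerD.
- exists (B1 + B2); split; first exact: addr_ge0.
  move=> a b t s tp sp; apply: (le_trans (ler_normD _ _)).
  by apply: lerD; [exact: g1B|exact: g2B].
Qed.

(** Monomials multiply by adding exponents, an error term absorbs the other factor because that
    factor is bounded, and the two inductions distribute over sums. *)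
Lemma jetM k l g h : jet k g -> jet l h ->
  jet (k + l) (fun a b t s => g a b t s * h a b t s).
Proof.
move=> jg jh; elim: jg => [c i j Bc kij|g' Og|g1 g2 _ h1 _ h2]; last first.
- by apply: (jet_eq _ (jet_add h1 h2)) => a b t s; rewrite mulrDl.
- by apply: jet_bigO; apply: bounded_bigO => //; exact: jet_bounded jh.
elim: jh => [c' i' j' Bc' lij|g' Og|g1 g2 _ h1 _ h2].
- apply: (@jet_eq _ (fun a b t s => (c a b * c' a b) * t ^+ (i + i') * s ^+ (j + j'))).
    by move=> a b t s; rewrite !exprD; ring.
  apply: (@jet_mono _ (fun a b => c a b * c' a b)).
    case: Bc Bc' => B cB [B' cB']; exists (B * B') => a b.
    by rewrite normrM ler_pM.
  by rewrite addnACA leq_add.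
- apply: jet_bigO; have := jet_bounded (jet_mono Bc kij).
  move=> /(bounded_bigO Og); congr bigO.
  by do 4!(apply: funext => ?); rewrite mulrC.
- by apply: (jet_eq _ (jet_add h1 h2)) => a b t s; rewrite mulrDr.
Qed.

Lemma jet_coef c : (exists B, forall a b, `|c a b| <= B) -> jet 0 (fun a b _ _ => c a b).
Proof.
move=> Bc; apply: (jet_eq _ (@jet_mono 0 c 0 0 Bc isT)) => a b t s.
by rewrite !mulr1.
Qed.

Lemma jet_cst (x : R) : jet 0 (fun _ _ _ _ => x).
Proof. by apply: (@jet_coef (fun _ _ => x)); exists `|x|. Qed.

Lemma jetZ k c g : (exists B, forall a b, `|c a b| <= B) -> jet k g ->
  jet k (fun a b t s => c a b * g a b t s).
Proof. by move=> Bc jg; rewrite -[k]add0n; apply: jetM => //; exact: jet_coef. Qed.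

Lemma jetB k g h : jet k g -> jet k h -> jet k (fun a b t s => g a b t s - h a b t s).
Proof.
move=> jg jh; have jNh := @jetZ k (fun _ _ => -1) h _ jh.
apply: (jet_eq _ (jet_add jg (jNh _))) => [a b t s|]; first by rewrite mulN1r.
by exists 1 => a b; rewrite normrN1.
Qed.

Lemma jet_sum k m (g : 'I_m -> R -> R -> R -> R -> R) : (forall i, jet k (g i)) ->
  jet k (fun a b t s => \sum_(i < m) g i a b t s).
Proof.
elim: m g => [|m ih] g jg.
  apply: jet_bigO; exists 0; split => // a b t s _ _.
  by rewrite big_ord0 normr0 mul0r.
have := jet_add (jg ord0) (ih (fun i => g (lift ord0 i)) (fun i => jg _)).
by apply: jet_eq => a b t s; rewrite big_ord_recl.
Qed.

Lemma jetX k g i : jet k g -> jet (k * i) (fun a b t s => g a b t s ^+ i).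
Proof.
move=> jg; elim: i => [|i ih].
  by rewrite muln0; apply: jet_eq (jet_cst 1) => a b t s; rewrite expr0.
by rewrite mulnS; apply: jet_eq (jetM jg ih) => a b t s; rewrite exprS.
Qed.

Lemma jet_t : jet 1 (fun _ _ t _ => t).
Proof.
apply: jet_eq (@jet_mono 1 (fun _ _ => 1) 1 0 _ isT) => [a b t s|].
  by rewrite mulr1 mul1r.
by exists 1 => a b; rewrite normr1.
Qed.

Lemma jet_swap k g : jet k g -> jet k (fun a b t s => g a b s t).
Proof.
elim=> [c i j Bc kij|g' [C [C0 gC]]|g1 g2 _ h1 _ h2].
- rewrite addnC in kij; apply: jet_eq (jet_mono Bc kij) => a b t s.
  by rewrite mulrAC.
- apply: jet_bigO; exists C; split => // a b t s tp sp.
  by rewrite addrC; exact: gC.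
- exact: jet_add.
Qed.

Lemma jet_s : jet 1 (fun _ _ _ s => s).
Proof. exact: jet_swap jet_t. Qed.

(** Telescoping: [g^(i+1) - h^(i+1) = g^i (g - h) + (g^i - h^i) h], where [g] has order 1 like [h],
    so that both summands have order [i + 2]. *)
Lemma jetXB g h i : jet 1 h -> jet 2 (fun a b t s => g a b t s - h a b t s) ->
  jet i.+1 (fun a b t s => g a b t s ^+ i - h a b t s ^+ i).
Proof.
move=> jh jgh.
have jg : jet 1 g.
  apply: jet_eq (jet_add (@jetW 1 2 _ isT jgh) jh) => a b t s.
  by rewrite subrK.
elim: i => [|i ih].
  apply: jet_bigO; exists 0; split => // a b t s _ _.
  by rewrite subrr normr0 mul0r.
have j1 := jetM (jetX i jg) jgh; rewrite mul1n addn2 in j1.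
have j2 := jetM ih jh; rewrite addn1 in j2.
by apply: jet_eq (jet_add j1 j2) => a b t s; rewrite !exprSr; ring.
Qed.

Lemma jet_sin (phi : R -> R -> R) :
  jet 2 (fun a b t s => sin (phi a b + t) - sin (phi a b) - cos (phi a b) * t).
Proof.
(* The [k]-th derivative of [sin (x + y)] in [y] is a phase shift by [k] quarter turns; all of them
   are bounded by 1, hence the uniformity in [phi]. *)
pose G x k y : R := sin (x + y + k%:R * (pi / 2)).
have dG x k (y : R) : is_derive y (1 : R) (G x k) (G x k.+1 y).
  have -> : G x k.+1 y = cos (x + y + k%:R * (pi / 2)) * (0 + 1 + 0).
    by rewrite /G -natr1 mulrDl mul1r addrA sinDpihalf addr0 add0r mulr1.
  exact: is_derive1_comp.
have G1 x k y : `|G x k y| <= 1.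
  by rewrite ler_norml sin_geN1 sin_le1.
(* Order [n.+2] instead of [n] lets the constant and linear terms be split off whatever [n] is. *)
have tay x := @taylor1 R n.+2 (G x) 1 (fun k y _ => dG x k y) (G1 x n.+2).
pose c k a b : R := G (phi a b) k 0 / k`!%:R.
have cB k : exists B, forall a b, `|c k a b| <= B.
  exists `|(k`!%:R)^-1| => a b; rewrite normrM -[leRHS]mul1r.
  by rewrite ler_wpM2r.
have jS : jet 2 (fun a b t s => \sum_(k < n) c k.+2 a b * t ^+ k.+2 * s ^+ 0).
  by apply: jet_sum => k; exact: jet_mono.
apply: jet_eq (jet_add jS (@jet_bigO _ (fun a b t s => sin (phi a b + t) -
   sin (phi a b) - cos (phi a b) * t -
   \sum_(k < n) c k.+2 a b * t ^+ k.+2 * s ^+ 0) _)) => [a b t s|].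
  by rewrite addrC subrK.
(* The two surplus powers of [|t|] in the remainder are bounded by [pi ^+ 2]. *)
exists (pi ^+ 2); split; first by rewrite exprn_ge0// pi_ge0.
move=> a b t s tp sp.
have := tay (phi a b) t; rewrite !big_ord_recl /= mul1r => le1.
have -> : sin (phi a b + t) - sin (phi a b) - cos (phi a b) * t -
   \sum_(k < n) c k.+2 a b * t ^+ k.+2 * s ^+ 0 = 
   G (phi a b) 0 t - (G (phi a b) 0 0 / 0`!%:R * t ^+ 0 +
     (G (phi a b) (bump 0 0) 0 / (bump 0 0)`!%:R * t ^+ bump 0 0 +
    \sum_(i < n) G (phi a b) (bump 0 (bump 0 i)) 0 / (bump 0 (bump 0 i))`!%:R *
     t ^+ bump 0 (bump 0 i))).
  rewrite /bump !leq0n /= !add1n /G !mul0r !mul1r !addr0 sinDpihalf.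
  rewrite fact0 factS fact0 !divr1 expr0 expr1 mulr1 !opprD !addrA; congr (_ - _).
  by apply: eq_bigr => i _; rewrite mulr1 /c /G !add1n addr0.
apply: (le_trans le1); rewrite -addn2 exprD mulrC ler_pM// ?exprn_ge0//.
  by rewrite lerXn2r// ?nnegrE// pi_ge0.
by apply: lerXn2r; rewrite ?nnegrE ?addr_ge0 ?lerDl.
Qed.

Lemma jet_cos (phi : R -> R -> R) :
  jet 2 (fun a b t s => cos (phi a b + t) - cos (phi a b) + sin (phi a b) * t).
Proof.
apply: jet_eq (jet_sin (fun a b => phi a b + pi / 2)) => a b t s.
by rewrite [_ + t]addrAC !sinDpihalf cosDpihalf mulNr opprK.
Qed.

End Jets.

(** * Monomials in the increments approximated by polynomials in space *)

Definition angles (R : realType) (a b : R) : 'rV[R]_2 :=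
  \row_(i < 2) nth 0 [:: a; b] i.

Section Approximation.
Variables (R : realType) (Rt r : R).
Hypotheses (r_gt0 : 0 < r) (r_ltRt : r < Rt).
Variable d : nat.
Implicit Types (g h : R -> R -> R -> R -> R) (a b t s : R).

Local Notation tubeR a := (Rt + r * cos a).
Local Notation pt a b := (Phi Rt r (angles a b)).

Lemma PhiE a b : [/\ pt a b 0 0 = tubeR a * cos b,
  pt a b 0 1 = tubeR a * sin b & pt a b 0 2 = r * sin a].
Proof. by split; rewrite /Phi /angles !mxE. Qed.

Lemma tubeR_ge a : Rt - r <= tubeR a.
Proof. by rewrite lerD2l -mulrN1 ler_pM2l// cos_geN1. Qed.

Lemma tubeR_gt0 a : 0 < tubeR a.
Proof. by apply: lt_le_trans (tubeR_ge a); rewrite subr_gt0. Qed.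

(** The constant comes before the base point and the polynomial after it: only the error bound has
    to be uniform. *)
Definition poly_approx g := exists C : R, 0 <= C /\ forall a b,
  exists q, polyspace Rt r d q /\ forall t s, `|t| <= pi -> `|s| <= pi ->
    `|g a b t s - q (pt (a + t) (b + s))| <= C * (`|t| + `|s|) ^+ d.+1.

Lemma poly_approx_eq g h : (forall a b t s, g a b t s = h a b t s) ->
  poly_approx g -> poly_approx h.
Proof.
move=> gh; suff -> : h = g by [].
by do 4!(apply: funext => ?); rewrite gh.
Qed.

Lemma poly_approxD g h : poly_approx g -> poly_approx h ->
  poly_approx (fun a b t s => g a b t s + h a b t s).
Proof.
move=> [C [C0 gC]] [B [B0 hB]]; exists (C + B); split; first exact: addr_ge0.
move=> a b; have [q [dq qC]] := gC a b; have [p [dp pB]] := hB a b.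
exists (fun x => q x + p x); split; first exact: polyspaceD.
move=> t s tp sp; rewrite opprD addrACA mulrDl.
by apply: (le_trans (ler_normD _ _)); apply: lerD; [exact: qC|exact: pB].
Qed.

Lemma poly_approxZ (c : R -> R -> R) g : (exists B, forall a b, `|c a b| <= B) ->
  poly_approx g -> poly_approx (fun a b t s => c a b * g a b t s).
Proof.
move=> [B cB] [C [C0 gC]]; have B0 : 0 <= B by apply: le_trans (cB 0 0).
exists (B * C); split; first exact: mulr_ge0.
move=> a b; have [q [dq qC]] := gC a b.
exists (fun x => c a b * q x); split; first exact: polyspaceZ.
by move=> t s tp sp; rewrite -mulrBr normrM -mulrA ler_pM// qC.
Qed.

Lemma poly_approx_bigO g : bigO d.+1 g -> poly_approx g.
Proof.
move=> [C [C0 gC]]; exists C; split => // a b; exists (fun=> 0).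
by split=> [|t s tp sp]; [exact: polyspace_cst|rewrite subr0 gC].
Qed.

Lemma poly_approx_poly (q : R -> R -> 'rV[R]_3 -> R) :
  (forall a b, polyspace Rt r d (q a b)) ->
  poly_approx (fun a b t s => q a b (pt (a + t) (b + s))).
Proof.
move=> dq; exists 0; split => // a b; exists (q a b); split => // t s _ _.
by rewrite subrr normr0 mul0r.
Qed.

(** Reduces a jet to its monomials: [poly_approx] contains the error terms and is stable under sums
    and bounded coefficients. *)
Lemma poly_approx_jet k g :
  (forall i j, (k <= i + j)%N -> poly_approx (fun _ _ t s => t ^+ i * s ^+ j)) ->
  jet d.+1 k g -> poly_approx g.
Proof.
move=> km; elim=> [c i j Bc kij|g' Og|g1 g2 _ h1 _ h2].
- by apply: poly_approx_eq (poly_approxZ Bc (km _ _ kij)) => a b t s; rewrite mulrA.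
- exact: poly_approx_bigO.
- exact: poly_approxD.
Qed.

(* Affine coordinates in the tangent plane at [pt a b]; they agree with the
   angle increments to first order. *)
Definition chart0 a b (x : 'rV[R]_3) : R :=
  r^-1 * (cos a * x 0 2 + - sin a * (cos b * x 0 0 + sin b * x 0 1) +
          sin a * Rt).

Definition chart1 a b (x : 'rV[R]_3) : R :=
  (tubeR a)^-1 * (cos b * x 0 1 + - sin b * x 0 0).

Lemma polyspace_chart0 a b : polyspace Rt r 1 (chart0 a b).
Proof.
apply: polyspaceZ; apply: polyspaceD; last exact: polyspace_cst.
do !(apply: polyspaceD || apply: polyspaceZ); exact: polyspace_coord.
Qed.

Lemma polyspace_chart1 a b : polyspace Rt r 1 (chart1 a b).
Proof.
by apply: polyspaceZ; apply: polyspaceD; apply: polyspaceZ; exact: polyspace_coord.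
Qed.

Let sinB : exists B, forall a b : R, `|sin a| <= B.
Proof. by exists 1 => a _; rewrite ler_norml sin_geN1 sin_le1. Qed.

Let cosB : exists B, forall a b : R, `|cos a| <= B.
Proof. by exists 1 => a _; rewrite ler_norml cos_geN1 cos_le1. Qed.

Lemma jet_tubeR n : jet n 1 (fun a b t s => tubeR (a + t) - tubeR a).
Proof.
have j1 := @jetW _ n 1 2 _ isT (jet_cos n (fun a _ => a)).
have j2 := jetZ sinB (jet_t R n).
apply: jet_eq (jetM (jet_cst n r) (jetB j1 j2)) => a b t s.
by ring.
Qed.

Lemma jet_tubeR0 n : jet n 0 (fun a b t s => tubeR (a + t)).
Proof.
apply: jet_eq (jet_add (@jetW _ n 0 1 _ isT (jet_tubeR n))
   (@jet_coef _ n (fun a _ => tubeR a) _)) => [a b t s|].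
  by rewrite subrK.
exists (`|Rt| + `|r|) => a _; apply: (le_trans (ler_normD _ _)).
rewrite lerD2l normrM -[leRHS]mulr1 ler_wpM2l//.
by rewrite ler_norml cos_geN1 cos_le1.
Qed.

Lemma jet_sin0 n : jet n 2 (fun _ _ t _ => sin t - t).
Proof.
apply: jet_eq (jet_sin n (fun _ _ => 0)) => a b t s.
by rewrite add0r sin0 cos0 subr0 mul1r.
Qed.

Lemma jet_cos0 n : jet n 2 (fun _ _ t _ => cos t - 1).
Proof.
apply: jet_eq (jet_cos n (fun _ _ => 0)) => a b t s.
by rewrite add0r sin0 cos0 mul0r addr0.
Qed.

(** On the torus the chart equals [sin t + r^-1 * sin a * tubeR (a + t) * (1 - cos s)], and both
    [sin t - t] and [1 - cos s] have order 2. *)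
Lemma jet_chart0 n : jet n 2 (fun a b t s => chart0 a b (pt (a + t) (b + s)) - t).
Proof.
have j1 := jetZ cosB (jet_sin n (fun a _ => a)).
have j2 := jetZ sinB (jet_cos n (fun a _ => a)).
have j3 := jetZ sinB (jetM (jet_tubeR0 n) (jet_swap (jet_cos0 n))).
apply: jet_eq (jetB (jetB j1 j2) (jetM (jet_cst n r^-1) j3)) => a b t s.
rewrite /chart0; have [-> -> ->] := PhiE (a + t) (b + s).
have -> : cos b * (tubeR (a + t) * cos (b + s)) +
  sin b * (tubeR (a + t) * sin (b + s)) = tubeR (a + t) * cos s.
  rewrite (cosD b) (sinD b); have := cos2Dsin2 b; set c := cos b; set S := sin b => e.
  transitivity (tubeR (a + t) * cos s * (c ^+ 2 + S ^+ 2)); first by ring.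
  by rewrite e mulr1.
have e := cos2Dsin2 a; have rn0 : r != 0 by rewrite gt_eqF.
apply/eqP; rewrite -subr_eq0; apply/eqP.
(* The two sides differ by a multiple of the Pythagorean identity at [a]. *)
transitivity (t * (1 - (cos a ^+ 2 + sin a ^+ 2))); last by rewrite e subrr mulr0.
by field; exact: rn0.
Qed.

(** On the torus the chart equals [tubeR (a + t) / tubeR a * sin s]; here [sin s - s] has order 2,
    and the change of [tubeR] has order 1 and is multiplied by [s]. The denominator stays above
    [Rt - r]. *)
Lemma jet_chart1 n : jet n 2 (fun a b t s => chart1 a b (pt (a + t) (b + s)) - s).
Proof.
have j1 := jetM (jet_tubeR0 n) (jet_swap (jet_sin0 n)).
have j2 := jetM (jet_tubeR n) (jet_s R n).
have tB : exists B, forall a b : R, `|(tubeR a)^-1| <= B.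
  exists (Rt - r)^-1 => a b; have tR0 := tubeR_gt0 a.
  rewrite gtr0_norm ?invr_gt0//.
  by rewrite lef_pV2 ?posrE ?tubeR_gt0 ?subr_gt0// tubeR_ge.
apply: jet_eq (jetZ tB (jet_add j1 j2)) => a b t s.
rewrite /chart1; have [-> -> _] := PhiE (a + t) (b + s).
have -> : cos b * (tubeR (a + t) * sin (b + s)) +
  - sin b * (tubeR (a + t) * cos (b + s)) = tubeR (a + t) * sin s.
  rewrite (cosD b) (sinD b); have := cos2Dsin2 b; set c := cos b; set S := sin b => e.
  transitivity (tubeR (a + t) * sin s * (c ^+ 2 + S ^+ 2)); first by ring.
  by rewrite e mulr1.
by field; rewrite gt_eqF// tubeR_gt0.
Qed.

(* Downward induction on the degree: the product of powers of the charts is a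
   polynomial which differs from the monomial by terms of higher order. *)
Lemma poly_approx_monomial i j : poly_approx (fun _ _ t s => t ^+ i * s ^+ j).
Proof.
have [k] := ubnP (d.+1 - (i + j))%N; elim: k i j => // k ih i j.
(* Beyond degree [d] the monomial is itself an error term; its surplus degree goes into the
   constant. *)
have [dij _|ijd kd] := ltnP d (i + j).
  apply: poly_approx_bigO; exists ((pi + pi) ^+ (i + j - d.+1)).
  have pp0 : 0 <= pi + pi :> R by apply: addr_ge0; exact: pi_ge0.
  split; first exact: exprn_ge0.
  move=> a b t s tp sp; have ts0 : 0 <= `|t| + `|s| by exact: addr_ge0.
  apply: (@le_trans _ _ ((`|t| + `|s|) ^+ (i + j))).
    rewrite exprD normrM !normrX ler_pM ?exprn_ge0//.
      by apply: lerXn2r; rewrite ?nnegrE// lerDl.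
    by apply: lerXn2r; rewrite ?nnegrE// lerDr.
  rewrite -{1}(subnK dij) exprD ler_wpM2r ?exprn_ge0//.
  by apply: lerXn2r; rewrite ?nnegrE ?ts0 ?pp0 ?lerD.
pose q a b x := chart0 a b x ^+ i * chart1 a b x ^+ j.
have dq a b : polyspace Rt r d (q a b).
  apply: polyspaceW ijd _; rewrite -[i]mul1n -[j in (_ + j)%N]mul1n.
  apply: polyspaceM; apply: polyspaceX.
    exact: polyspace_chart0.
  exact: polyspace_chart1.
pose F0 a b t s := chart0 a b (pt (a + t) (b + s)).
pose F1 a b t s := chart1 a b (pt (a + t) (b + s)).
have jq : jet d.+1 (i + j).+1
    (fun a b t s => q a b (pt (a + t) (b + s)) - t ^+ i * s ^+ j).
  have j0 := jetXB i (jet_t R d.+1) (jet_chart0 d.+1).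
  have j1 := jetXB j (jet_s R d.+1) (jet_chart1 d.+1).
  have jF0 : jet d.+1 1 F0.
    apply: jet_eq (jet_add (@jetW _ d.+1 1 2 _ isT (jet_chart0 d.+1)) (jet_t _ _)).
    by move=> a b t s; rewrite subrK.
  have := jetM j0 (jetX j (jet_s R d.+1)); rewrite mul1n addSn => k1.
  have := jetM (jetX i jF0) j1; rewrite mul1n addnS => k2.
  (* The difference splits as [(F0^i - t^i) s^j + F0^i (F1^j - s^j)]. *)
  by apply: jet_eq (jet_add k1 k2) => a b t s; rewrite /q /F0; ring.
apply: poly_approx_eq (poly_approxD (poly_approx_poly dq)
  (@poly_approxZ (fun _ _ => -1) _ _ (poly_approx_jet _ jq))) => [a b t s||i' j' ij].
- by rewrite /=; ring.
- by exists 1 => a b; rewrite normrN1.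
- by apply: ih; lia.
Qed.

End Approximation.

(** * Periodic functions and reduction modulo a period *)

Section Periodicity.

Lemma periodicz (U V : zmodType) (f : U -> V) (T : U) : periodic f T ->
  forall (z : int) a, f (a + T *~ z) = f a.
Proof.
move=> fT [n|n] a; first exact: periodicn.
by rewrite NegzE mulrNz -[LHS](periodicn fT n.+1) subrK.
Qed.

Lemma periodic_partial (R : realType) n (i : 'I_n) (g : 'rV[R]_n -> R) T :
  periodic g T -> periodic (partial i g) T.
Proof.
move=> gT x; rewrite /partial /derive.
suff -> : (fun h : R => h^-1 *: ((g \o shift (x + T)) (h *: 'e_i) - g (x + T))) =
  (fun h : R => h^-1 *: ((g \o shift x) (h *: 'e_i) - g x)) by [].
by apply: funext => h; rewrite /= addrA !gT.
Qed.

Lemma periodic_iter_partial (R : realType) n (i : 'I_n) k (g : 'rV[R]_n -> R) T :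
  periodic g T -> periodic (iter k (partial i) g) T.
Proof. by move=> gT; elim: k => // k ih; exact: periodic_partial. Qed.

Lemma mod2pi (R : realType) (x : R) :
  exists z : int, 0 <= x + (pi *+ 2) *~ z <= pi *+ 2.
Proof.
have p0 : 0 < pi *+ 2 :> R by rewrite mulrn_wgt0// pi_gt0.
exists (- Num.floor (x / (pi *+ 2))).
have /andP[l u] := floor_itv (x / (pi *+ 2)).
rewrite mulrNz -mulrzl subr_ge0 lerBlDl; apply/andP; split.
  by rewrite -ler_pdivlMr.
by rewrite -[X in _ + X]mul1r -mulrDl -ler_pdivrMr// ltW// -intrD1.
Qed.

End Periodicity.

(** * Taylor's formula in two variables *)

Section TwoVariableTaylor.
Variable R : realType.
Implicit Types (G : 'rV[R]_2 -> R) (a b t s M : R).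

Lemma anglesD a b t s : angles (a + t) (b + s) = angles a b + angles t s.
Proof. by apply/rowP => -[[|[|//]] ?]; rewrite !mxE. Qed.

Lemma angles_e0 t : angles t 0 = t *: 'e_0.
Proof. by apply/rowP => -[[|[|//]] ?]; rewrite !mxE/= ?mulr1 ?mulr0. Qed.

Lemma angles_e1 s : angles 0 s = s *: 'e_1.
Proof. by apply/rowP => -[[|[|//]] ?]; rewrite !mxE/= ?mulr1 ?mulr0. Qed.

(** Both derivatives are limits of one and the same difference quotient. *)
Lemma is_derive_slice (g : R -> R) G x (v u : 'rV[R]_2) :
  (forall h : R, g (h + x) = G (h *: v + u)) -> derivable G u v ->
  is_derive x (1 : R) g ('D_v G u).
Proof.
move=> gG dG.
have e : (fun h : R => h^-1 *: ((g \o shift x) (h *: (1 : R)) - g x)) =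
         (fun h : R => h^-1 *: ((G \o shift u) (h *: v) - G u)).
  have gx : g x = G u by rewrite -[x]add0r gG scale0r add0r.
  by apply: funext => h /=; rewrite gx -gG -[h *: 1]/(h * 1) mulr1.
by apply: DeriveDef; rewrite /derivable /derive e.
Qed.

Lemma is_derive_angle0 G a b t : derivable G (angles (a + t) b) 'e_0 ->
  is_derive t (1 : R) (fun x => G (angles (a + x) b)) (partial 0 G (angles (a + t) b)).
Proof.
apply: is_derive_slice => h.
by rewrite -angles_e0 -anglesD add0r; congr (G (angles _ _)); ring.
Qed.

Lemma is_derive_angle1 G a b s : derivable G (angles a (b + s)) 'e_1 ->
  is_derive s (1 : R) (fun y => G (angles a (b + y))) (partial 1 G (angles a (b + s))).
Proof.
apply: is_derive_slice => h.
by rewrite -angles_e1 -anglesD add0r; congr (G (angles _ _)); ring.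
Qed.

Lemma Ck_iter_partial n (U : set 'rV[R]_n) (i : 'I_n) k j g :
  Ck_on U (k + j) g -> Ck_on U k (iter j (partial i) g).
Proof.
elim: j k => [|j ih] k; first by rewrite addn0.
by rewrite addnS -addSn => /ih[_ /(_ i)[_]].
Qed.

(** The derivatives are taken in the same order as in [Ck_norm]. *)
Definition mixed G i j := iter i (partial 0) (iter j (partial 1) G).

(** Expand in [s] from [(a + t, b)] to order [n], then the coefficient of each [s ^+ j] in [t] to
    order [n - j]. This leaves [n.+1] remainders, each at most [M * (|t| + |s|) ^+ n]. *)
Lemma taylor2 n G M a b t s : Ck_on setT n G ->
  (forall i j u, (i + j <= n)%N -> `|mixed G i j u| <= M) ->
  `|G (angles (a + t) (b + s)) -
    \sum_(j < n) \sum_(i < n - j)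
      mixed G i j (angles a b) / i`!%:R / j`!%:R * t ^+ i * s ^+ j|
  <= n.+1%:R * M * (`|t| + `|s|) ^+ n.
Proof.
move=> CG DM.
have M0 : 0 <= M by apply: le_trans (DM 0%N 0%N 0 isT).
have w0 : 0 <= `|t| + `|s| by exact: addr_ge0.
have st : `|s| <= `|t| + `|s| by rewrite lerDr.
have ts : `|t| <= `|t| + `|s| by rewrite lerDl.
have t1 : `|G (angles (a + t) (b + s)) -
    \sum_(j < n) mixed G 0 j (angles (a + t) b) / j`!%:R * s ^+ j| <= M * `|s| ^+ n.
  pose g j y := mixed G 0 j (angles (a + t) (b + y)).
  have := @taylor1 R n g M _ _ s; rewrite /g addr0; apply.
    move=> k x kn; apply: is_derive_angle1.
    have := @Ck_iter_partial _ setT 1 (n - k) k G.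
    rewrite subnK 1?ltnW// => /(_ CG); rewrite -(subnSK kn).
    by move=> [_ /(_ 1)[+ _]]; apply.
  by move=> x; exact: DM.
have t2 (j : 'I_n) : `|mixed G 0 j (angles (a + t) b) -
    \sum_(i < n - j) mixed G i j (angles a b) / i`!%:R * t ^+ i| <= M * `|t| ^+ (n - j).
  pose g i x := mixed G i j (angles (a + x) b).
  have := @taylor1 R (n - j) g M _ _ t; rewrite /g addr0; apply.
    move=> k x kn; apply: is_derive_angle0.
    have := @Ck_iter_partial _ setT 1 (n - j) j G.
    rewrite subnK 1?ltnW// => /(_ CG) C1.
    have := @Ck_iter_partial _ setT 0 (n - j - k) k (iter j (partial 1) G).
    rewrite subnK 1?ltnW// => /(_ C1); rewrite -(subnSK kn).
    by move=> [_ /(_ 0)[+ _]]; apply.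
  by move=> x; apply: DM; rewrite subnK// ltnW.
rewrite -(subrK (\sum_(j < n) mixed G 0 j (angles (a + t) b) / j`!%:R * s ^+ j)
   (G _)) -addrA -sumrB.
apply: (le_trans (ler_normD _ _)).
rewrite -natr1 addrC !mulrDl mul1r; apply: lerD; last first.
  apply: (le_trans t1); rewrite ler_wpM2l//.
  by apply: lerXn2r; rewrite ?nnegrE.
apply: (le_trans (ler_norm_sum _ _ _)).
rewrite -mulrA mulr_natl -[X in _ *+ X]card_ord -sumr_const.
apply: ler_sum => j _.
have -> : mixed G 0 j (angles (a + t) b) / j`!%:R * s ^+ j -
    \sum_(i < n - j) mixed G i j (angles a b) / i`!%:R / j`!%:R * t ^+ i * s ^+ j
  = (mixed G 0 j (angles (a + t) b) -
    \sum_(i < n - j) mixed G i j (angles a b) / i`!%:R * t ^+ i) * (s ^+ j / j`!%:R).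
  rewrite mulrBl mulr_suml; congr (_ - _); first by rewrite mulrAC mulrA.
  by apply: eq_bigr => i _; ring.
rewrite normrM -[n in leRHS](@subnK j n) 1?ltnW// exprD mulrA.
apply: ler_pM => //.
  apply: (le_trans (t2 j)); rewrite ler_wpM2l//.
  by apply: lerXn2r; rewrite ?nnegrE.
rewrite normrM normrX -[leRHS]mulr1; apply: ler_pM; rewrite ?exprn_ge0//.
  by apply: lerXn2r; rewrite ?nnegrE.
by rewrite ger0_norm ?invr_ge0// invf_le1 ?ltr0n ?fact_gt0// ler1n fact_gt0.
Qed.

End TwoVariableTaylor.

(** * Angles and Euclidean distance on the torus *)

Section TorusGeometry.
Variable R : realType.

(** Double angle formula, [cos (x *+ 2)] being nonnegative. *)
Lemma cos_sqr_ge (x : R) : `|x| <= pi / 4 -> 1 / 2 <= cos x ^+ 2.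
Proof.
rewrite ler_norml => /andP[l u].
have c0 : 0 <= cos (x *+ 2).
  apply: cos_ge0_pihalf; rewrite [x *+ 2]mulr2n; move: (@pi R) l u => p l u.
  by apply/andP; split; lra.
by move: c0; rewrite cos_mulr2n [_ ^+ 2 *+ 2]mulr2n; move: (cos x ^+ 2) => c c0; lra.
Qed.

(** With [y = x / 4], [1 - cos x = 8 sin^2 y cos^2 y], and [sin y = y cos c] with
    [|c| <= |y| <= pi / 4]; both squared cosines are at least 1/2. *)
Lemma one_sub_cos_ge (x : R) : `|x| <= pi -> x ^+ 2 / 8 <= 1 - cos x.
Proof.
move=> xpi.
have x4 : `|x / 4| <= pi / 4 by rewrite normrM [`|4^-1|]ger0_norm// ler_pM2r.
have [c cx] := mvt0 (x / 4) (@is_derive_sin R).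
rewrite sin0 subr0 => e.
have c1 := cos_sqr_ge (le_trans cx x4).
have c2 := cos_sqr_ge x4.
have -> : x = (x / 4) *+ 2 *+ 2 by rewrite -mulrnA -mulr_natr; field.
rewrite [in leRHS]cos_mulr2n; set y := x / 4 in e c2 *.
have s2 : sin (y *+ 2) ^+ 2 = 4 * sin y ^+ 2 * cos y ^+ 2.
  by rewrite mulr2n sinD; ring.
have := cos2Dsin2 (y *+ 2); rewrite s2 e => h.
have y2 : 0 <= y ^+ 2 by exact: sqr_ge0.
have cc : 1 / 4 <= cos c ^+ 2 * cos y ^+ 2.
  have -> : 1 / 4 = 1 / 2 * (1 / 2) :> R by field.
  by apply: ler_pM.
have ycc := ler_wpM2l y2 cc.
have -> : (y *+ 2 *+ 2) ^+ 2 / 8 = 2 * y ^+ 2 :> R.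
  by rewrite -mulrnA -mulr_natr; field.
have -> : 1 - (cos (y *+ 2) ^+ 2 *+ 2 - 1) = 2 - cos (y *+ 2) ^+ 2 *+ 2 by ring.
rewrite mulr2n; nra.
Qed.

Lemma circle_angle (x y : R) : x ^+ 2 + y ^+ 2 = 1 ->
  exists a, x = cos a /\ y = sin a.
Proof.
move=> e.
have x1 : -1 <= x <= 1.
  by rewrite -ler_norml -(@expr_le1 _ 2)// real_normK ?num_real// -e lerDl sqr_ge0.
have cx : cos (acos x) = x by apply: acosK; rewrite in_itv/= .
have sx : sin (acos x) = `|y|.
  by rewrite sin_acos// -sqrtr_sqr; congr Num.sqrt; rewrite -e; ring.
have [y0|y0] := leP 0 y.
  by exists (acos x); rewrite cx sx ger0_norm.
by exists (- acos x); rewrite cosN sinN cx sx ltr0_norm// opprK.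
Qed.

Variables (Rt r : R).
Hypotheses (r_gt0 : 0 < r) (r_ltRt : r < Rt).

(** The first angle is read off the meridian circle, the second off the horizontal circle of radius
    [rho], which is positive because [r < Rt]. *)
Lemma torus_angles x : torus Rt r x -> exists a b, x = Phi Rt r (angles a b).
Proof.
rewrite /torus /=; set rho := Num.sqrt _ => e.
have r0 : r != 0 by rewrite gt_eqF.
have [|a [ca sa]] := @circle_angle ((rho - Rt) / r) (x 0 2 / r).
  by rewrite !exprMn -mulrDl e exprVn divff// expf_neq0.
have rhoE : rho = Rt + r * cos a by rewrite -ca; field.
have rho0 : rho != 0 by rewrite rhoE gt_eqF// tubeR_gt0.
have rho2 : rho ^+ 2 = x 0 0 ^+ 2 + x 0 1 ^+ 2.
  by rewrite sqr_sqrtr// addr_ge0// sqr_ge0.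
have [|b [cb sb]] := @circle_angle (x 0 0 / rho) (x 0 1 / rho).
  by rewrite !exprMn -mulrDl -rho2 exprVn divff// expf_neq0.
exists a, b; have [P0 P1 P2] := PhiE Rt r a b.
apply/rowP => -[[|[|[|//]]] i].
- rewrite (_ : Ordinal i = 0) ?P0; last exact/val_inj.
  by rewrite -rhoE -cb mulrC divfK.
- rewrite (_ : Ordinal i = 1) ?P1; last exact/val_inj.
  by rewrite -rhoE -sb mulrC divfK.
- rewrite (_ : Ordinal i = 2) ?P2; last exact/val_inj.
  by rewrite -sa mulrC divfK.
Qed.

(** Converts errors measured in the increments into errors measured in Euclidean distance. *)
Lemma dE_Phi_ge a b t s : `|t| <= pi -> `|s| <= pi ->
  Num.min r (Rt - r) / 3 * (`|t| + `|s|) <=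
  dE (Phi Rt r (angles a b)) (Phi Rt r (angles (a + t) (b + s))).
Proof.
move=> tp sp; rewrite /dE; set m := Num.min _ _.
have m0 : 0 < m by rewrite lt_min r_gt0 subr_gt0.
have [mr mR] : m <= r /\ m <= Rt - r by rewrite !ge_min !lexx orbT.
rewrite -[leLHS]ger0_norm; last by rewrite mulr_ge0 ?addr_ge0// divr_ge0// ltW.
rewrite -sqrtr_sqr ler_wsqrtr//.
rewrite !big_ord_recl big_ord0 addr0.
have [P0 P1 P2] := PhiE Rt r a b; have [Q0 Q1 Q2] := PhiE Rt r (a + t) (b + s).
rewrite (_ : lift ord0 (lift ord0 ord0) = 2); last exact/val_inj.
rewrite (_ : lift ord0 ord0 = 1); last exact/val_inj.
rewrite P0 P1 P2 Q0 Q1 Q2.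
set u := Rt + r * cos a; set v := Rt + r * cos (a + t).
have um : m <= u by apply: le_trans mR (tubeR_ge _ r_gt0 _).
have vm : m <= v by apply: le_trans mR (tubeR_ge _ r_gt0 _).
(* Exact squared chord length, a sum of one nonnegative term for each increment. *)
have -> : (u * cos b - v * cos (b + s)) ^+ 2 +
    ((u * sin b - v * sin (b + s)) ^+ 2 + (r * sin a - r * sin (a + t)) ^+ 2) =
   2 * r ^+ 2 * (1 - cos t) + 2 * (u * v) * (1 - cos s).
  have eb := cos2Dsin2 b; have es := cos2Dsin2 s.
  have ea := cos2Dsin2 a; have et := cos2Dsin2 t.
  have -> : (r * sin a - r * sin (a + t)) ^+ 2 =
    2 * r ^+ 2 * (1 - cos t) - (u - v) ^+ 2.
    rewrite /u /v sinD cosD; apply/eqP; rewrite -subr_eq0; apply/eqP.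
    transitivity (r ^+ 2 * ((cos a ^+ 2 + sin a ^+ 2) *
      (1 - 2 * cos t + (cos t ^+ 2 + sin t ^+ 2)) - 2 * (1 - cos t))).
      by ring.
    by rewrite ea et; ring.
  rewrite sinD cosD; apply/eqP; rewrite -subr_eq0; apply/eqP.
  transitivity ((cos b ^+ 2 + sin b ^+ 2) *
    (u ^+ 2 - 2 * u * v * cos s + v ^+ 2 * (cos s ^+ 2 + sin s ^+ 2)) -
    (u ^+ 2 + v ^+ 2 - 2 * u * v * cos s)); first by ring.
  by rewrite eb es; ring.
have ct := one_sub_cos_ge tp; have cs := one_sub_cos_ge sp.
have rm : m * m <= r ^+ 2 by rewrite expr2 ler_pM// ltW.
have uvm : m * m <= u * v by rewrite ler_pM// ltW.
(* The middle term is at least [m^2 (|t| + |s|)^2 / 8], which the factor 1/3 undercuts since 1/9 is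
   below 1/8. *)
apply: (@le_trans _ _ (2 * (m * m * (t ^+ 2 / 8)) + 2 * (m * m * (s ^+ 2 / 8)))).
  rewrite -[t ^+ 2]real_normK ?num_real// -[s ^+ 2]real_normK ?num_real//.
  move: `|t| `|s| => t' s'; have := sqr_ge0 (m * (t' - s')).
  have := sqr_ge0 (m * t'); have := sqr_ge0 (m * s'); nra.
have mm : 0 <= m * m by rewrite mulr_ge0// ltW.
rewrite -(mulrA 2 (r ^+ 2)) -(mulrA 2 (u * v)).
by apply: lerD; rewrite ler_pM2l// ler_pM// divr_ge0// sqr_ge0.
Qed.

End TorusGeometry.

(** * Local polynomial approximation on the torus *)

Section LocalPolynomial.
Variables (R : realType) (Rt r : R).
Hypotheses (r_gt0 : 0 < r) (r_ltRt : r < Rt).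
Local Notation twopi := (pi *+ 2 : R).

Lemma angles_mulz (t s : R) (z : int) : angles t s *~ z = angles (t *~ z) (s *~ z).
Proof.
have nat_case n : angles t s *+ n = angles (t *+ n) (s *+ n).
  by apply/rowP => -[[|[|//]] ?]; rewrite mulmxnE !mxE.
case: z => n; rewrite ?NegzE ?mulrNz -!pmulrn nat_case//.
by apply/rowP => -[[|[|//]] ?]; rewrite !mxE.
Qed.

Lemma periodic_Phi0 : periodic (Phi Rt r) (angles twopi 0).
Proof.
move=> u; rewrite /Phi; suff [-> ->] : (u + angles twopi 0) 0 0 = u 0 0 + twopi /\
    (u + angles twopi 0) 0 1 = u 0 1 by rewrite sinD2pi cosD2pi.
by rewrite !mxE /= addr0.
Qed.

Lemma periodic_Phi1 : periodic (Phi Rt r) (angles 0 twopi).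
Proof.
move=> u; rewrite /Phi; suff [-> ->] : (u + angles 0 twopi) 0 0 = u 0 0 /\
    (u + angles 0 twopi) 0 1 = u 0 1 + twopi by rewrite sinD2pi cosD2pi.
by rewrite !mxE /= addr0.
Qed.

Lemma rowE2 (u : 'rV[R]_2) : u = angles (u 0 0) (u 0 1).
Proof.
by apply/rowP => -[[|[|//]] ?]; rewrite !mxE /=; congr (u 0 _); exact/val_inj.
Qed.

Lemma period_square_shift (u : 'rV[R]_2) : exists z0 z1 : int,
  period_square (u + angles twopi 0 *~ z0 + angles 0 twopi *~ z1).
Proof.
have [z0 h0] := mod2pi (u 0 0); have [z1 h1] := mod2pi (u 0 1).
exists z0, z1; rewrite !angles_mulz !mul0rz.
rewrite [u in u + _]rowE2 -!anglesD !addr0 => -[[|[|//]] ?]; rewrite !mxE /=.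
  by rewrite [2 * pi]mulr_natl; exact: h0.
by rewrite addr0 [2 * pi]mulr_natl; exact: h1.
Qed.

(** Integer multiples of the two periods bring [u] into the period square without changing the
    derivatives. *)
Lemma Ck_norm_mixed k f M : (Ck_norm Rt r k f <= M%:E)%E ->
  forall i j u, (i + j <= k)%N -> `|mixed (f \o Phi Rt r) i j u| <= M.
Proof.
move=> fM i j u ijk.
have ik : (i < k.+1)%N by rewrite ltnS (leq_trans _ ijk)// leq_addr.
have jk : (j < k.+1)%N by rewrite ltnS (leq_trans _ ijk)// leq_addl.
have [z0 [z1 us]] := period_square_shift u.
have per T : periodic (Phi Rt r) T -> periodic (mixed (f \o Phi Rt r) i j) T.
  move=> PT; do 2!apply: periodic_iter_partial.
  by move=> x; rewrite /= PT.
rewrite -lee_fin; apply: le_trans fM.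
apply: (@le_trans _ _ (supnorm (@period_square R) (mixed (f \o Phi Rt r) i j))).
  apply: ereal_sup_ubound; eexists; first exact: us.
  by rewrite !(periodicz (per _ _))//; [exact: periodic_Phi0|exact: periodic_Phi1].
exact: (@le_bigmax_cond _ _ _ _ (Ordinal ik, Ordinal jk)
  (fun a : 'I_k.+1 * 'I_k.+1 => (a.1 + a.2 <= k)%N)
  (fun a : 'I_k.+1 * 'I_k.+1 => supnorm (@period_square R)
     (iter a.1 (partial 0) (iter a.2 (partial 1) (f \o Phi Rt r))))).
Qed.

Lemma torus_increments a b y : torus Rt r y -> exists t s,
  [/\ `|t| <= pi, `|s| <= pi & y = Phi Rt r (angles (a + t) (b + s))].
Proof.
move=> /(torus_angles r_gt0 r_ltRt)[a' [b' ->]].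
have shift (x x' : R) : exists z : int, `|x' + twopi *~ z - x| <= pi.
  (* The offset [pi] turns the range [[0, 2 pi]] into [[-pi, pi]]. *)
  have [z /andP[l u]] := mod2pi (x' - x + pi); exists z; rewrite ler_norml.
  move: l u; move: (twopi *~ z) => w; rewrite [_ *+ 2]mulr2n; move: (@pi R) => p.
  by move=> l u; apply/andP; split; lra.
have [z0 t0] := shift a a'; have [z1 s1] := shift b b'.
exists (a' + twopi *~ z0 - a), (b' + twopi *~ z1 - b); split => //.
rewrite !subrKC.
have -> : angles (a' + twopi *~ z0) (b' + twopi *~ z1) =
  angles a' b' + angles twopi 0 *~ z0 + angles 0 twopi *~ z1.
  by rewrite !angles_mulz !mul0rz -!anglesD !addr0.
by rewrite (periodicz periodic_Phi1) (periodicz periodic_Phi0).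
Qed.

Lemma local_polynomial d : exists C, 0 < C /\
  forall (f : 'rV[R]_3 -> R) M x, Ck_torus Rt r d.+1 f ->
    (Ck_norm Rt r d.+1 f <= M%:E)%E -> torus Rt r x ->
    exists q, polyspace Rt r d q /\ forall y, torus Rt r y ->
      `|f y - q y| <= C * M * dE x y ^+ d.+1.
Proof.
(* The constants of the monomials are chosen before [f] and [x], so the final one is uniform. *)
have [c cP] := choice (fun ij : nat * nat =>
  poly_approx_monomial r_gt0 r_ltRt d ij.1 ij.2).
(* The term [d.+2] pays for the Taylor remainder of order [d.+1], the sum for replacing each
   monomial by its polynomial. *)
pose K := d.+2%:R + \sum_(j < d.+1) \sum_(i < d.+1 - j) c (val i, val j).
have K0 : 0 < K.
  apply: ltr_pwDl => //; apply: sumr_ge0 => j _; apply: sumr_ge0 => i _.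
  by have [] := cP (val i, val j).
pose m := Num.min r (Rt - r) / 3.
have m0 : 0 < m by rewrite divr_gt0// lt_min r_gt0 subr_gt0.
exists (K / m ^+ d.+1); split; first by rewrite divr_gt0// exprn_gt0.
move=> f M x Cf fM /(torus_angles r_gt0 r_ltRt)[a [b ->]].
have DM := Ck_norm_mixed fM.
have M0 : 0 <= M by apply: le_trans (DM 0%N 0%N 0 isT).
have [q qP] := choice (fun ij : nat * nat => (cP ij).2 a b).
pose e i j := mixed (f \o Phi Rt r) i j (angles a b) / i`!%:R / j`!%:R.
have eM i j : (i + j <= d.+1)%N -> `|e i j| <= M.
  have inv1 k : `|(k`!%:R)^-1| <= 1 :> R.
    by rewrite ger0_norm ?invr_ge0// invf_le1 ?ltr0n ?fact_gt0// ler1n fact_gt0.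
  move=> ij; rewrite /e !normrM -[leRHS]mulr1 ler_pM ?mulr_ge0//.
  by rewrite -[leRHS]mulr1 ler_pM// DM.
exists (fun y => \sum_(j < d.+1) \sum_(i < d.+1 - j) e i j * q (val i, val j) y); split.
  apply: polyspace_sum => j _; apply: polyspace_sum => i _; apply: polyspaceZ.
  by have [] := qP (val i, val j).
move=> _ /(torus_increments a b)[t [s [tp sp ->]]].
set y := Phi _ _ _.
have w0 : 0 <= `|t| + `|s| by exact: addr_ge0.
apply: (@le_trans _ _ (K * M * (`|t| + `|s|) ^+ d.+1)); last first.
  rewrite [K / _ * M]mulrAC -[leRHS]mulrA ler_wpM2l//.
    by rewrite mulr_ge0// ltW.
  rewrite -exprVn -exprMn; apply: lerXn2r; rewrite ?nnegrE//.
    by apply: mulr_ge0; [rewrite invr_ge0 ltW|exact: sqrtr_ge0].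
  by rewrite ler_pdivlMl//; exact: dE_Phi_ge.
rewrite -(subrK (\sum_(j < d.+1) \sum_(i < d.+1 - j) e i j * t ^+ i * s ^+ j) (f y)).
rewrite -addrA -sumrB; apply: (le_trans (ler_normD _ _)).
rewrite -[K * M * _]mulrA [K * _]mulrDl; apply: lerD.
  by rewrite mulrA; exact: (taylor2 a b t s Cf DM).
rewrite mulr_suml; apply: (le_trans (ler_norm_sum _ _ _)); apply: ler_sum => j _.
rewrite -sumrB mulr_suml; apply: (le_trans (ler_norm_sum _ _ _)).
apply: ler_sum => i _; rewrite -mulrA -mulrBr normrM mulrCA.
apply: ler_pM => //.
  by apply: eM; rewrite addnC -leq_subRL ?(ltnW (ltn_ord i))// ltnW.
by have [_] := qP (val i, val j); apply.
Qed.

End LocalPolynomial.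

(** * Lagrange interpolation on one stencil *)

Section Interpolation.
Variables (R : realType) (Rt r : R) (d m : nat) (s : 'I_m -> 'rV[R]_3).
Hypothesis us : unisolvent Rt r d s.

Lemma interpolantP y : polyspace Rt r d (interpolant Rt r d s y) /\
  interpolates s y (interpolant Rt r d s y).
Proof.
apply: (@xgetPex _ _ [set p | polyspace Rt r d p /\ interpolates s y p]).
by have [p [dp yp _]] := us y; exists p.
Qed.

Lemma fundamental_polyE k l : fundamental_poly Rt r d s k (s l) = (k == l)%:R.
Proof. by have [_ /(_ l)] := interpolantP (fun l => (k == l)%:R). Qed.

(** Both sides interpolate [y], so unisolvence identifies them on the torus. *)
Lemma lagrange_interpolation y p x : polyspace Rt r d p -> interpolates s y p ->
  torus Rt r x -> p x = \sum_k y k * fundamental_poly Rt r d s k x.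
Proof.
move=> dp yp Tx; have [q [dq yq qu]] := us y.
rewrite (qu _ dp yp _ Tx); apply/esym.
apply: (qu (fun x => \sum_k y k * fundamental_poly Rt r d s k x)) => //.
  apply: polyspace_sum => k _; apply: polyspaceZ.
  by have [] := interpolantP (fun l => (k == l)%:R).
move=> l; rewrite (bigD1 l)//= big1 => [|k kl].
  by rewrite fundamental_polyE eqxx mulr1 addr0.
by rewrite fundamental_polyE (negbTE kl) mulr0.
Qed.

(** Interpolation reproduces the constant 1. This later makes the stability factor strictly
    positive. *)
Lemma sum_fundamental_poly_ge1 x : torus Rt r x ->
  1 <= \sum_k `|fundamental_poly Rt r d s k x|.
Proof.
move=> Tx; have := @lagrange_interpolation (fun=> 1) (fun=> 1) x.
move=> /(_ (polyspace_cst _ _ _ _) (fun=> erefl) Tx) e.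
rewrite [leLHS]e; under eq_bigr do rewrite mul1r.
exact: le_trans (ler_norm _) (ler_norm_sum _ _ _).
Qed.

(** Interpolation reproduces [q], so the error at [x] is the interpolant of [q - f], whose nodal
    values are at most [B]. *)
Lemma interpolation_error f q x B : polyspace Rt r d q -> torus Rt r x ->
  f x = q x -> (forall k, `|f (s k) - q (s k)| <= B) ->
  `|f x - interpolant Rt r d s (f \o s) x| <=
    B * \sum_k `|fundamental_poly Rt r d s k x|.
Proof.
move=> dq Tx fq fB; have [dI yI] := interpolantP (f \o s).
rewrite (lagrange_interpolation dI yI Tx) fq.
rewrite (lagrange_interpolation dq (y := q \o s) (fun=> erefl) Tx) -sumrB.
apply: (le_trans (ler_norm_sum _ _ _)); rewrite mulr_sumr; apply: ler_sum => k _.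
by rewrite -mulrBl normrM ler_wpM2r// distrC fB.
Qed.

End Interpolation.

(** * Error of the Shepard operator at a point *)

Lemma dE_xx (R : realType) n (x : 'rV[R]_n) : dE x x = 0.
Proof. by rewrite /dE big1 ?sqrtr0// => i _; rewrite subrr expr0n. Qed.

Section ShepardError.
Variables (R : realType) (Rt r : R) (d m : nat) (N : node_system R m) (mu : R).
Hypothesis validN : valid_node_system Rt r d N.

(** The real-valued function whose supremum over the torus is [stability_factor]. *)
Definition local_stability x : R :=
  \big[Num.max/0]_(j < nstencils N | j \in active Rt r N x)
     \sum_(k < m) `|fundamental_poly Rt r d (stencil j) k x|.

Lemma local_stability_le x : torus Rt r x ->
  ((local_stability x)%:E <= stability_factor Rt r d N)%E.
Proof. by move=> Tx; apply: ereal_sup_ubound; exists x. Qed.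

Lemma stencil_torus (j : 'I_(nstencils N)) l : torus Rt r (stencil j l).
Proof.
by case: validN => _ NT NE _ _; apply: NT; rewrite NE; exists j => //; exists l.
Qed.

Lemma unisolvent_stencil (j : 'I_(nstencils N)) : unisolvent Rt r d (stencil j).
Proof. by case: validN => _ _ _ /(_ j)[]. Qed.

Lemma dE_active x (j : 'I_(nstencils N)) l : active Rt r N x j ->
  dE x (stencil j l) <= max_radius N.
Proof.
move=> [_ /interior_subset[_ /(_ l)]] /le_trans; apply.
exact: (le_bigmax _ (fun j : 'I_(nstencils N) => support_radius j)).
Qed.

Lemma max_radius_gt0 x : active Rt r N x !=set0 -> 0 < max_radius N.
Proof.
case=> j _; case: validN => _ _ _ _ /(_ j) /lt_le_trans; apply.
exact: (le_bigmax _ (fun j : 'I_(nstencils N) => support_radius j)).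
Qed.

Lemma local_stability_gt0 x : torus Rt r x -> active Rt r N x !=set0 ->
  0 < local_stability x.
Proof.
move=> Tx [j jx]; apply: lt_le_trans ltr01 _.
apply: le_trans (sum_fundamental_poly_ge1 (unisolvent_stencil j) Tx) _.
apply: (@le_bigmax_cond _ _ _ _ j (fun j => j \in active Rt r N x)
  (fun j : 'I_(nstencils N) =>
     \sum_(k < m) `|fundamental_poly Rt r d (stencil j) k x|)).
exact/mem_set.
Qed.

Lemma weight_ge0 (j : 'I_(nstencils N)) x : 0 <= weight mu j x.
Proof. by apply: prodr_ge0 => l _; exact: powR_ge0. Qed.

Lemma shepard_error f x q B : torus Rt r x -> ~ nodes N x ->
  0 < total_weight Rt r N mu x -> polyspace Rt r d q -> f x = q x -> 0 <= B ->
  (forall (j : 'I_(nstencils N)) k, active Rt r N x j ->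
     `|f (stencil j k) - q (stencil j k)| <= B) ->
  `|f x - shepard Rt r d N mu f x| <= B * local_stability x.
Proof.
move=> Tx nx W0 dq fq B0 fB; rewrite /shepard; case: ifPn => [/set_mem//|_].
set W := total_weight _ _ _ _ _ in W0.
have W1 : \sum_(j < nstencils N | j \in active Rt r N x)
    normalized_weight Rt r mu j x = 1.
  rewrite (eq_bigr (fun j => weight mu j x / W)) => [|j jx].
    by rewrite -mulr_suml divff// gt_eqF.
  by rewrite /normalized_weight jx.
(* Both [f x] and the bound are written as averages with these weights, which allows a comparison
   stencil by stencil. *)
rewrite -[f x]mul1r -{1}W1 mulr_suml -sumrB -[leRHS]mul1r -{1}W1 mulr_suml.
apply: (le_trans (ler_norm_sum _ _ _)); apply: ler_sum => j jx.
have w0 : 0 <= normalized_weight Rt r mu j x.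
  by rewrite /normalized_weight jx divr_ge0 ?weight_ge0// ltW.
rewrite -mulrBr normrM ger0_norm// ler_wpM2l//.
apply: le_trans (interpolation_error (unisolvent_stencil j) dq Tx fq _) _.
  by move=> k; apply: fB; exact/set_mem.
rewrite ler_wpM2l//.
exact: (@le_bigmax_cond _ _ _ _ j (fun j => j \in active Rt r N x)
  (fun j : 'I_(nstencils N) =>
     \sum_(k < m) `|fundamental_poly Rt r d (stencil j) k x|)).
Qed.

End ShepardError.

(** * The uniform error bound *)

Lemma Ck_norm_ge0 (R : realType) (Rt r : R) k f : (0 <= Ck_norm Rt r k f)%E.
Proof. exact: bigmax_ge_id. Qed.

Theorem theorem1 (R : realType) (Rt r : R) (hr : 0 < r) (hRt : r < Rt)
    (d : nat) (m : nat) (hm : has_dim Rt r (polyspace Rt r d) m)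
    (delta0 : R) (hdelta0 : tubular_radius Rt r delta0)
    (delta1 : R) (hdelta1 : 0 < delta1) (hdelta10 : delta1 < delta0) :
  exists C : R, 0 < C /\
    forall (I : set R) (N : R -> node_system R m),
      node_family Rt r d I N ->
      forall h : R, I h -> max_radius (N h) < delta1 ->
      forall mu : R, 0 < mu -> admissible_radii Rt r (N h) mu ->
      forall f : 'rV[R]_3 -> R, Ck_torus Rt r d.+1 f ->
        (supnorm (torus Rt r) (fun x => f x - shepard Rt r d (N h) mu f x)%R
         <= C%:E * stability_factor Rt r d (N h)
            * (max_radius (N h) ^+ d.+1)%R%:E * Ck_norm Rt r d.+1 f)%E.
Proof.
have [C [C0 CP]] := local_polynomial hr hRt d.
exists C; split => // I N [_ _ NI] h Ih _ mu mu0 [act W0] f Cf.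
have [validN _] := NI h Ih.
apply: ge_ereal_sup => _ [x Tx <-].
have rho0 := max_radius_gt0 validN (act x Tx).
have St0 := local_stability_gt0 validN Tx (act x Tx).
have StL := local_stability_le d (N h) Tx.
have L0 : (0 < stability_factor Rt r d (N h))%E.
  by apply: lt_le_trans StL; rewrite lte_fin.
(* Strict positivity makes the right side [+oo] for an infinite norm, whereas [0 * +oo] would be
   [0]. *)
have CLr0 : (0 < C%:E * stability_factor Rt r d (N h) *
    (max_radius (N h) ^+ d.+1)%R%:E)%E.
  by rewrite !mule_gt0// lte_fin// exprn_gt0.
have := Ck_norm_ge0 Rt r d.+1 f.
case nE: (Ck_norm Rt r d.+1 f) => [M| |//] M0; last by rewrite gt0_muley ?leey.
rewrite lee_fin in M0.
have [nx|nx] := pselect (nodes (N h) x).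
  rewrite /shepard mem_set// subrr normr0.
  by rewrite mule_ge0 ?lee_fin// ltW.
have [|q [dq qP]] := CP f M x Cf _ Tx; first by rewrite nE.
(* At [y = x] the bound on [f - q] vanishes, the exponent [d.+1] being positive. *)
have fq : f x = q x.
  apply/eqP; rewrite -subr_eq0 -normr_le0; apply: le_trans (qP x Tx) _.
  by rewrite dE_xx expr0n mulr0.
pose B := C * M * max_radius (N h) ^+ d.+1.
have B0 : 0 <= B by rewrite !mulr_ge0// ?exprn_ge0// ltW.
have err : `|f x - shepard Rt r d (N h) mu f x| <= B * local_stability Rt r d (N h) x.
  apply: (shepard_error validN Tx nx (W0 x Tx nx) dq fq B0) => j k jx.
  apply: le_trans (qP _ (stencil_torus validN j k)) _.
  rewrite ler_wpM2l ?mulr_ge0 ?(ltW C0)//; apply: lerXn2r.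
  - by rewrite nnegrE sqrtr_ge0.
  - by rewrite nnegrE ltW.
  - exact: dE_active jx.
apply: (@le_trans _ _ (B * local_stability Rt r d (N h) x)%:E).
  by rewrite lee_fin.
have -> : B * local_stability Rt r d (N h) x =
    C * local_stability Rt r d (N h) x * max_radius (N h) ^+ d.+1 * M.
  by rewrite /B; ring.
rewrite !EFinM lee_wpmul2r ?lee_fin// lee_wpmul2r ?lee_fin ?exprn_ge0 ?(ltW rho0)//.
by rewrite lee_wpmul2l// lee_fin ltW.
Qed.
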